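(* Let $b$ be a positive integer. Consider $b$-colored partitions of $n$ into odd parts: finite multisets of colored parts $r_c$ with $r$ a positive odd integer and $c\in\{1,\dots,b\}$, whose sizes $r$ (counted with multiplicity) sum to $n$. Let $F^o_k(n)$ be the total number of parts of size $k$ (of any color, with multiplicity) in all such partitions of $n$. For such a partition $\pi$, let $g^o_k(\pi)$ be the number of distinct colored parts $r_c$ that occur at least $k$ times in $\pi$, and let $G^o_k(n)=\sum_\pi g^o_k(\pi)$ over all $b$-colored partitions $\pi$ of $n$ into odd parts, with $G^o_k(m)=0$ for $m\le 0$. Then for all $n=1,2,\dots$ and all odd $k=1,3,5,\dots$, $$F^o_k(n)=G^o_k(n)+G^o_k(n-k).$$ *)

(* Defs.v *)
From mathcomp Require Import all_boot all_order all_algebra.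
From mathcomp Require Import finmap multiset.

Set Implicit Arguments.
Unset Strict Implicit.
Unset Printing Implicit Defensive.

Local Open Scope fset_scope.
Local Open Scope mset_scope.
Local Open Scope nat_scope.

(* The colored part r_c is the pair (r, c); the b colors are the elements of
   'I_b, i.e. they are numbered from 0 instead of from 1. *)
Notation cpart b := (nat * 'I_b)%type.

Definition odd_cpartition b n (pi : {mset cpart b}) : bool :=
  all (fun x : cpart b => odd x.1) pi && (\sum_(x <- pi) x.1 == n).

(* A partition of n into odd parts has at most n parts, each at most n, so all
   of them occur in this finite enumeration; see in_odd_cpartitions. *)
Definition odd_cpartitions b n : {fset {mset cpart b}} :=
  [fset pi in [seq seq_mset [seq (val x.1, x.2) | x <- val t]
                | t : n.-bseq ('I_n.+1 * 'I_b)]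
     | odd_cpartition n pi].

Lemma in_odd_cpartitions b n (pi : {mset cpart b}) :
  (pi \in odd_cpartitions b n) = odd_cpartition n pi.
Proof.
rewrite !inE /=; apply: andb_idl => /andP[/allP oddpi /eqP sumpi].
have le_pi x : x \in enum_mset pi -> x.1 <= n.
  by move=> xpi; rewrite -sumpi (big_rem x) //= leq_addr.
have size_pi : size [seq (inord x.1 : 'I_n.+1, x.2) | x <- enum_mset pi] <= n.
  rewrite size_map -sumpi -sum1_size big_seq [leqRHS]big_seq.
  by apply: leq_sum => x /oddpi; apply: odd_gt0.
apply/mapP; exists (Bseq size_pi); first by rewrite mem_enum.
rewrite /= -map_comp map_id_in ?seq_mset_id // => -[r c] /le_pi /= le_rn.
by rewrite inordK.
Qed.

Definition f_odd b k (pi : {mset cpart b}) : nat :=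
  count (fun x : cpart b => x.1 == k) pi.

Definition F_odd b k n : nat :=
  \sum_(pi <- odd_cpartitions b n) f_odd k pi.

Definition g_odd b k (pi : {mset cpart b}) : nat :=
  #|` [fset x in finsupp pi | k <= pi x]|.

(* The argument is an integer, so that n - k is a genuine subtraction. *)
Definition G_odd b k (m : int) : nat :=
  if (m <= 0)%R then 0
  else \sum_(pi <- odd_cpartitions b `|m|) g_odd k pi.

(* Main.v *)
Require Import Defs.
From mathcomp Require Import all_boot all_order all_algebra.
From mathcomp Require Import finmap multiset.
From mathcomp Require Import zify.

(** Call [q n d] (below, [num_odd_cpartitions_sub b n d]) the number of
    [b]-colored partitions of [n - d] into odd parts ([0] if [n < d]).
    Removing [j] copies of an odd part [r_c] shows that [q n (j * r)]
    partitions of [n] contain [r_c] at least [j] times.  Hence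
    [F_k(n) = b * \sum_(j >= 1) q n (j * k)], while
    [G_k(n) = b * \sum_(r odd) q n (k * r)] and, since [q (n - k) (k * r)] is
    [q n (k * (r + 1))], the term [G_k(n - k)] is the same sum over the even
    [r >= 2]. *)

Set Implicit Arguments.
Unset Strict Implicit.
Unset Printing Implicit Defensive.

Local Open Scope fset_scope.
Local Open Scope mset_scope.
Local Open Scope nat_scope.

Lemma card_fset_sep_sum (K : choiceType) (A : {fset K}) (P : pred K) :
  #|` [fset x in A | P x]| = \sum_(x <- A) P x.
Proof. by rewrite card_fset_sum1 -big_fset_condE big_mkcond. Qed.

Lemma perm_enum_msetD (K : choiceType) (A B : {mset K}) :
  perm_eq (A `+` B) (enum_mset A ++ enum_mset B).
Proof.
by apply/allP => x _ /=; rewrite count_cat !count_mem_mset msetE2.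
Qed.

Lemma odd_cpartition_msetnD b n j (x : cpart b) (pi : {mset cpart b}) :
  odd x.1 -> j * x.1 <= n ->
  odd_cpartition n (msetn j x `+` pi) = odd_cpartition (n - j * x.1) pi.
Proof.
move=> oddx le_jxn; rewrite /odd_cpartition (perm_all _ (perm_enum_msetD _ _)).
rewrite (perm_big _ (perm_enum_msetD _ _)) /= all_cat big_cat /= enum_msetn.
rewrite all_nseq oddx orbT big_nseq iter_addn_0 mulnC; congr (_ && _).
by apply/eqP/eqP; lia.
Qed.

Lemma msetn_subK (K : choiceType) j (x : K) (A : {mset K}) :
  j <= A x -> msetn j x `+` (A `\` msetn j x) = A.
Proof.
move=> le_jA; apply/msetP => y; rewrite !msetE2 msetnE.
by case: eqP => [->|_]; [rewrite subnKC | rewrite subn0].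
Qed.

Lemma leq_mult_weight b n (pi : {mset cpart b}) (x : cpart b) :
  odd_cpartition n pi -> pi x * x.1 <= n.
Proof.
case/andP=> _ /eqP <-; rewrite -{2}(msetn_subK (leqnn (pi x))).
rewrite (perm_big _ (perm_enum_msetD _ _)) /= big_cat /= enum_msetn.
by rewrite big_nseq iter_addn_0 mulnC leq_addr.
Qed.

(** The guard matters: for [n < d] the truncated [n - d] is 0, and the empty partition would be
    counted. *)
Definition num_odd_cpartitions_sub b n d : nat :=
  if d <= n then #|` odd_cpartitions b (n - d)| else 0.

Lemma sum_mset_geq b n j (x : cpart b) : odd x.1 ->
  \sum_(pi <- odd_cpartitions b n) (j <= pi x) =
  num_odd_cpartitions_sub b n (j * x.1).
Proof.
move=> oddx; rewrite /num_odd_cpartitions_sub; case: leqP => [le_jxn|lt_njx].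
  have injD : injective (fun pi : {mset cpart b} => msetn j x `+` pi).
    move=> A B eqAB; apply/msetP => y.
    by have /msetP/(_ y) := eqAB; rewrite !msetE2 => /addnI.
  (* Adding [j] copies of [x] is a bijection from the partitions of [n - j * x.1] onto those of [n]
     in which [x] occurs at least [j] times. *)
  transitivity
    #|` [fset msetn j x `+` pi | pi in odd_cpartitions b (n - j * x.1)]|.
    rewrite -card_fset_sep_sum; congr #|` _ |; apply/fsetP => pi.
    rewrite in_fset inE /= -[X in X && _]/(pi \in odd_cpartitions b n).
    rewrite in_odd_cpartitions; apply/andP/imfsetP => /= [[pin le_j]|].
      exists (pi `\` msetn j x); last by rewrite msetn_subK.
      by rewrite in_odd_cpartitions -(odd_cpartition_msetnD _ oddx) ?msetn_subK.
    case=> A; rewrite in_odd_cpartitions => AP ->.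
    by rewrite odd_cpartition_msetnD // AP msetE2 msetnxx leq_addr.
  by rewrite card_imfset.
rewrite big1_fset // => pi.
rewrite in_odd_cpartitions => /(leq_mult_weight x) le_n _.
case: leqP => // le_j; have := leq_trans (leq_mul le_j (leqnn x.1)) le_n.
by rewrite leqNgt lt_njx.
Qed.

(** Splits a multiplicity into threshold indicators. The bound [N] can be chosen the same for all
    partitions, which lets the sums be exchanged. *)
Lemma sum_nat_geq m N : m <= N -> \sum_(1 <= j < N.+1) (j <= m) = m.
Proof.
move=> le_mN; rewrite (big_cat_nat (n := m.+1)) //=.
rewrite [X in _ + X]big_nat_cond [X in _ + X]big1 ?addn0 => [|j]; last first.
  by case: (leqP j m).
rewrite big_nat_cond (eq_bigr (fun=> 1)) => [|j]; last first.
  by rewrite ltnS; case: (leqP j m); rewrite ?andbF.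
by rewrite -big_nat_cond sum_nat_const_nat subn1 muln1.
Qed.

Lemma f_oddE b k (pi : {mset cpart b}) : f_odd k pi = \sum_(c < b) pi (k, c).
Proof.
rewrite /f_odd -sum1_count big_mkcond.
under [RHS]eq_bigr do rewrite -count_mem_mset -sum1_count big_mkcond.
rewrite exchange_big /=; apply: eq_bigr => -[r c] _ /=.
(* A part [(r, c)] contributes only to the summand of its own color. *)
rewrite (bigD1 c) //= big1 => [|d /negPf neq_dc].
  by rewrite addn0 xpair_eqE eqxx andbT.
by rewrite xpair_eqE [c == d]eq_sym neq_dc andbF.
Qed.

Lemma g_oddE b k n N (pi : {mset cpart b}) : 0 < k -> n < N ->
  odd_cpartition n pi ->
  g_odd k pi = \sum_(0 <= r < N | odd r) \sum_(c < b) (k <= pi (r, c)).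
Proof.
move=> k_gt0 lt_nN pin; have /andP[/allP oddpi _] := pin.
(* A grid of candidate parts that does not depend on [pi]. *)
pose box :=
  [seq (r, c) | r <- [seq r <- index_iota 0 N | odd r], c <- index_enum 'I_b].
transitivity (size [seq x <- box | k <= pi x]).
  apply/perm_size/uniq_perm => [||[r c]]; first exact: fset_uniq.
    rewrite filter_uniq // allpairs_uniq ?index_enum_uniq //.
      by rewrite filter_uniq ?iota_uniq.
    by move=> [? ?] [? ?] _ _ /=.
  rewrite mem_filter !inE /= msuppE andbC; case: leqP => //= le_k.
  (* Since [0 < k], the part really occurs in [pi]; hence its size is odd and at most [n < N], so it
     lies in [box]. *)
  have rcpi : (r, c) \in pi by rewrite in_mset; apply: leq_trans le_k.
  rewrite rcpi; apply/esym/allpairsP; exists (r, c) => /=.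
  rewrite mem_filter mem_index_enum mem_index_iota (oddpi _ rcpi); split=> //=.
  apply: leq_ltn_trans lt_nN; apply: leq_trans (leq_mult_weight (r, c) pin).
  by rewrite leq_pmull // -in_mset.
by rewrite size_filter -sum1_count big_mkcond big_allpairs big_filter.
Qed.

(** Thresholds up to [n] suffice, because [pi (k, c) <= pi (k, c) * k <= n]. The factor [b] appears
    because all colors contribute equally. *)
Lemma F_oddE b k n : odd k ->
  F_odd b k n =
  b * \sum_(1 <= j < n.+1) num_odd_cpartitions_sub b n (j * k).
Proof.
move=> oddk; rewrite /F_odd big_seq.
under eq_bigr => pi.
  rewrite in_odd_cpartitions => pin.
  have leq_pi c : pi (k, c) <= n.
    apply: leq_trans (leq_mult_weight (k, c) pin).
    by rewrite leq_pmulr // odd_gt0.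
  rewrite f_oddE; under eq_bigr => c _ do rewrite -(sum_nat_geq (leq_pi c)).
  over.
rewrite -big_seq exchange_big /= -[X in X * _]card_ord -sum_nat_const.
apply: eq_bigr => c _; rewrite exchange_big /=; apply: eq_bigr => j _.
exact: (sum_mset_geq _ _ (x := (k, c))).
Qed.

(** The bound [N] is left free so that the ranges can be matched with that of [F_oddE] for both
    [m = n] and [m = n - k]. *)
Lemma G_oddE b k m N : 0 < k -> m < N ->
  G_odd b k m%:Z =
  b * \sum_(0 <= r < N | odd r) num_odd_cpartitions_sub b m (k * r).
Proof.
move=> k_gt0 lt_mN; case: m lt_mN => [|m] lt_mN.
  (* For [m = 0] the convention gives 0, and so does the sum, as [k * r > 0] for odd [r]. *)
  rewrite /G_odd /= big1 ?muln0 // => r oddr.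
  by rewrite /num_odd_cpartitions_sub leqNgt muln_gt0 k_gt0 odd_gt0.
rewrite /G_odd /= big_seq.
under eq_bigr => pi.
  rewrite in_odd_cpartitions => pin.
  rewrite (g_oddE k_gt0 lt_mN pin).
  over.
rewrite -big_seq exchange_big /= big_distrr /=; apply: eq_bigr => r oddr.
rewrite -[X in X * _]card_ord -sum_nat_const exchange_big /=.
apply: eq_bigr => c _; exact: (sum_mset_geq _ _ (x := (r, c))).
Qed.

Theorem theorem4 (b : nat) (hb : (0 < b)%N) (n k : nat)
    (hn : (0 < n)%N) (hk : odd k) :
  F_odd b k n = (G_odd b k (n%:Z)%R + G_odd b k (n%:Z - k%:Z)%R)%N.
Proof.
have k_gt0 := odd_gt0 hk.
(* Odd [j] account for the term at [n], even [j] for the term at [n - k]. *)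
rewrite F_oddE // (@G_oddE _ _ _ n.+1) // (bigID odd) mulnDr /=; congr (_ + _).
  rewrite [in RHS]big_ltn_cond //=; congr (_ * _).
  by apply: eq_bigr => r _; rewrite mulnC.
have [le_nk|lt_kn] := leqP n k.
  rewrite /G_odd ifT; last by lia.
  (* A positive even [r] is at least 2, so [r * k >= 2 * k > n]. *)
  rewrite big_nat_cond big1 ?muln0 // => r /andP[/andP[r_gt0 _] evenr].
  rewrite /num_odd_cpartitions_sub ifF //; apply/negbTE; rewrite -ltnNge.
  by case: r r_gt0 evenr => [|[|r]] // _ _; nia.
have -> : (n%:Z - k%:Z)%R = Posz (n - k) by lia.
rewrite (@G_oddE _ _ _ n) //; last by lia.
(* Shifting the index by one turns even [j >= 1] into odd [r >= 0]; with [N = n] the ranges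
   agree. *)
rewrite big_add1 /=; congr (_ * _); apply: eq_big => r; first by rewrite negbK.
move=> _; rewrite /num_odd_cpartitions_sub mulSn mulnC.
by rewrite (leq_subRL _ (ltnW lt_kn)) subnDA.
Qed.
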